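(* Let $(X,\|\cdot\|_X)$ be a normed space whose dual $X^*$ is separable, let $(Y,\|\cdot\|_Y)$ be a normed space, and let $\Phi=(\phi_k)_{k\geq 1}$ be a dense subset of $B_{X^*}(1)$. Let $|u|_\Phi := \sum_{k=1}^\infty 2^{-k}|\langle \phi_k,u\rangle|$ for $u\in X$. Let $T:X\to Y$ be a linear operator such that for any $\varepsilon>0$ there exists a constant $C_\varepsilon>0$ with $$\|Tu\|_Y\leq \varepsilon\|u\|_X+C_\varepsilon|u|_\Phi \qquad\text{for all } u\in X.$$ Then $T:(X,\|\cdot\|_X)\to (Y,\|\cdot\|_Y)$ is completely continuous.
   Context: $\langle\cdot,\cdot\rangle$ denotes the duality pairing between $X^*$ and $X$; $B_{X^*}(1)$ is the closed unit ball of $X^*$ for the dual norm, and density of $\Phi$ is with respect to the dual norm. A linear operator $T:X\to Y$ between normed spaces is completely continuous if it maps every weakly convergent sequence in $X$ to a strongly convergent sequence in $Y$. *)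

(* Defs.v *)
From HB Require Import structures.
From mathcomp Require Import all_boot all_order all_algebra.
From mathcomp Require Import all_classical all_reals all_analysis.
Import Order.TTheory GRing.Theory Num.Theory.
Import numFieldNormedType.Exports.

Set Implicit Arguments.
Unset Strict Implicit.
Unset Printing Implicit Defensive.

Local Open Scope classical_set_scope.
Local Open Scope ring_scope.

(** The topological dual [dual X] of a real normed space [X]: continuous linear
    functionals with the pointwise operations and the dual norm. *)
Section dual.
Context {R : realType} (X : normedModType R).

Definition cont_linear : {pred X -> R} :=
  mem [set f : X -> R | linear f /\ continuous f].

Fact cont_linear_submod_closed : submod_closed cont_linear.
Proof.
split=> [|a f g]; rewrite !inE /=.
  split; last exact: cst_continuous.
  by move=> a x y; rewrite scaler0 addr0.
move=> [lf cf] [lg cg]; split=> [b x y|x].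
  rewrite !fctE lf lg !scalerDr !scalerA -!addrA (mulrC a b).
  by congr (_ + _); rewrite addrCA.
by apply: cvgD; [apply: cvgZr; exact: cf | exact: cg].
Qed.

HB.instance Definition _ :=
  GRing.isSubmodClosed.Build R (X -> R) cont_linear cont_linear_submod_closed.

Record dual : Type := Dual {
  dual_fun :> X -> R;
  dual_funP : dual_fun \in cont_linear }.

HB.instance Definition _ := [isSub for dual_fun].
HB.instance Definition _ := [Choice of dual by <:].
HB.instance Definition _ := [SubChoice_isSubLmodule of dual by <:].

Implicit Types f g : dual.

Lemma dual_linear f : linear f.
Proof. by have := dual_funP f; rewrite inE /= => -[]. Qed.

Lemma dual_continuous f : continuous f.
Proof. by have := dual_funP f; rewrite inE /= => -[]. Qed.

HB.instance Definition _ f :=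
  GRing.isLinear.Build R X R _ (dual_fun f) (dual_linear f).

Definition dual_norm f : R := sup [set `|f x| | x in [set x : X | `|x| <= 1]].

Lemma dual_has_sup f : has_sup [set `|f x| | x in [set x : X | `|x| <= 1]].
Proof.
split; first by exists `|f 0|, 0 => //=; rewrite normr0.
have /bounded_funP/(_ 1)[M fM] : bounded_near f (nbhs (0 : X)).
  exact/linear_bounded_continuous/dual_continuous.
by exists M => _ [x x1 <-]; exact: fM.
Qed.

Lemma dual_norm_ub f x : `|x| <= 1 -> `|f x| <= dual_norm f.
Proof.
move=> x1; apply: ub_le_sup; first exact: (dual_has_sup f).2.
by exists x.
Qed.

Lemma dual_norm_le f (M : R) :
  (forall x : X, `|x| <= 1 -> `|f x| <= M) -> dual_norm f <= M.
Proof.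
move=> fM; apply: ge_sup; first exact: (dual_has_sup f).1.
by move=> _ [x x1 <-]; exact: fM.
Qed.

Fact dual_normD f g : dual_norm (f + g) <= dual_norm f + dual_norm g.
Proof.
apply: dual_norm_le => x x1; rewrite (le_trans (ler_normD _ _))//.
by rewrite lerD// dual_norm_ub.
Qed.

Fact dual_normZ (a : R) f : dual_norm (a *: f) = `|a| * dual_norm f.
Proof.
have le (b : R) g : dual_norm (b *: g) <= `|b| * dual_norm g.
  apply: dual_norm_le => x x1.
  by rewrite [leLHS]normrM ler_wpM2l// dual_norm_ub.
have [->|a0] := eqVneq a 0.
  rewrite scale0r normr0 mul0r; apply/eqP; rewrite eq_le; apply/andP; split.
    by apply: dual_norm_le => x _; rewrite normr0.
  by rewrite (le_trans (normr_ge0 ((0 : dual) 0)))// dual_norm_ub// normr0.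
apply/eqP; rewrite eq_le le/=.
rewrite -ler_pdivlMl ?normr_gt0// -normfV.
by by have := le a^-1 (a *: f); rewrite scalerA mulVf// scale1r.
Qed.

Fact dual_norm0_eq0 f : dual_norm f = 0 -> f = 0.
Proof.
move=> f0; apply/val_inj/funext => x /=; apply/eqP; rewrite -normr_le0.
have [->|x0] := eqVneq x 0; first by rewrite linear0 normr0.
have := @dual_norm_ub f (`|x|^-1 *: x).
rewrite f0 linearZ normrZ normfV normr_id mulVf ?normr_eq0// => /(_ (lexx _)).
by rewrite /= normrM normfV normr_id pmulr_rle0// invr_gt0 normr_gt0.
Qed.

HB.instance Definition _ := Lmodule_isNormed.Build R dual
  dual_normD dual_normZ dual_norm0_eq0.

Lemma dual_normE f : `|f| = sup [set `|f x| | x in [set x : X | `|x| <= 1]].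
Proof. by []. Qed.

End dual.

Definition separable (T : topologicalType) :=
  exists2 D : set T, countable D & dense D.

Definition dense_subset (T : topologicalType) (B A : set T) :=
  A `<=` B /\ B `<=` closure A.

(** Only the values [phi k] with [1 <= k] matter. The series converges as soon
    as these values are bounded in the dual norm. *)
Definition Phi_norm {R : realType} (X : normedModType R) (phi : nat -> dual X)
    (u : X) : R :=
  \big[+%R/0]_(1 <= k <oo) (2 ^- k * `|phi k u|).

Definition weakly_cvg_to {R : realType} (X : normedModType R) (u : nat -> X)
    (l : X) :=
  forall f : dual X, (fun n => f (u n)) @ \oo --> f l.

Definition completely_continuous {R : realType} (X Y : normedModType R)
    (T : {linear X -> Y}) :=
  forall u : nat -> X,
    (exists l : X, weakly_cvg_to u l) -> cvgn (fun n => T (u n)).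

(* Main.v *)
Require Import Defs.
From HB Require Import structures.
From mathcomp Require Import all_boot all_order all_algebra.
From mathcomp Require Import all_classical all_reals all_analysis.
From mathcomp Require Import lra.
Import Order.TTheory GRing.Theory Num.Theory.
Import numFieldNormedType.Exports.
Local Open Scope classical_set_scope.
Local Open Scope ring_scope.

(** The argument is that a weakly convergent sequence [u n] with weak limit [l]
    is bounded in norm and, for bounded sequences, weak convergence forces
    convergence for the weaker norm [Phi_norm phi].  With [v n := u n - l], the
    hypothesis on [T] then bounds [`|T (v n)|] by [eps * M] plus a term that
    tends to [0], where [M] bounds every [`|v n|]; as [eps] is arbitrary,
    [T (u n)] converges to [T l].

    Boundedness ([weakly_cvg_bounded]) is the uniform boundedness principle
    applied to the evaluations [f |-> f (u n)] on the dual, which is a Banach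
    space ([dual_complete]).  It bounds these
    evaluations uniformly on the unit ball of the dual, and the Hahn-Banach
    theorem ([norming_functional]) identifies the norm of the [n]-th one with
    [`|u n|].

    The Hahn-Banach theorem is proved without extending functionals from
    subspaces: by Zorn's lemma every sublinear functional dominates a minimal
    one, a minimal sublinear functional is linear, and starting the descent
    from [tilt p x0] instead of [p] forces the value [p x0] at [x0].

    Convergence for [Phi_norm phi] ([Phi_norm_weakly_small]) is dominated
    convergence for series: since each [phi k] is in the unit ball, the
    remainder after [N] terms is at most [2 ^- N] times the norm, and each of
    the first [N] terms tends to [0]. *)

(** * The Hahn-Banach theorem through minimal sublinear functionals *)

Definition sublinear {R : realType} {V : lmodType R} (q : V -> R) :=
  (forall x y, q (x + y) <= q x + q y) /\
  (forall (t : R) x, 0 <= t -> q (t *: x) = t * q x).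

Section hahn_banach.
Context {R : realType} {V : lmodType R}.
Implicit Types (p q : V -> R) (x y : V).

Lemma sublinear0 q : sublinear q -> q 0 = 0.
Proof. by move=> [_ /(_ 0 0 (lexx 0))]; rewrite scale0r mul0r. Qed.

Lemma sublinear_ge q x : sublinear q -> - q (- x) <= q x.
Proof.
by move=> qs; have := qs.1 x (- x); rewrite subrr sublinear0//; lra.
Qed.

(** Directedness is what makes the infimum subadditive: functionals nearly
    attaining the infimum at [x] and at [y] have a common lower bound in [A]. *)
Lemma sublinear_inf (A : set (V -> R)) :
  A !=set0 -> (forall q, A q -> sublinear q) ->
  (forall x, has_lbound [set q x | q in A]) ->
  (forall q r, A q -> A r ->
    exists2 s, A s & forall x, s x <= q x /\ s x <= r x) ->
  sublinear (fun x => inf [set q x | q in A]).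
Proof.
move=> [q0 Aq0] Asub Alb Adir.
have hi x : has_inf [set q x | q in A] by split => //; exists (q0 x), q0.
have infle q x : A q -> inf [set q x | q in A] <= q x.
  by move=> Aq; apply: ge_inf => //; exists q.
split => [x y|t x t0].
  apply/ler_addgt0Pr => e e0.
  have [_ [q Aq <-] qx] := inf_adherent (divr_gt0 e0 (ltr0n R 2)) (hi x).
  have [_ [r Ar <-] ry] := inf_adherent (divr_gt0 e0 (ltr0n R 2)) (hi y).
  have [s As sqr] := Adir _ _ Aq Ar.
  have := infle s (x + y) As; have := (Asub _ As).1 x y.
  by have := (sqr x).1; have := (sqr y).2; lra.
apply/eqP; rewrite eq_le; apply/andP; split; last first.
  apply: lb_le_inf; first by exists (q0 (t *: x)), q0.
  move=> _ [q Aq <-]; rewrite (Asub _ Aq).2//.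
  by rewrite ler_wpM2l// infle.
move: t0; rewrite [0 <= t]le_eqVlt => /predU1P[<-|t0].
  rewrite mul0r; apply: le_trans (infle _ _ Aq0) _.
  by rewrite (Asub _ Aq0).2// mul0r.
rewrite -ler_pdivrMl//; apply: lb_le_inf; first by exists (q0 x), q0.
move=> _ [q Aq <-]; rewrite ler_pdivrMl// -(Asub _ Aq).2 ?(ltW t0)//.
exact: infle.
Qed.

(** For sublinear [q], the largest sublinear functional below [q] whose value at [- x] is at most
    [- q x], that is, which is forced to be linear along the line through
    [x]. *)
Definition tilt q x y : R :=
  inf [set q (y + t *: x) - t * q x | t in [set t : R | 0 <= t]].

Let tilt_has_inf q x y : sublinear q ->
  has_inf [set q (y + t *: x) - t * q x | t in [set t : R | 0 <= t]].
Proof.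
move=> qs; split; first by exists (q (y + 0 *: x) - 0 * q x), 0 => /=.
exists (- q (- y)) => _ [s /= s0 <-].
by have := qs.1 (y + s *: x) (- y); rewrite addrAC subrr add0r qs.2//; lra.
Qed.

Lemma tilt_le q x y (t : R) : sublinear q -> 0 <= t ->
  tilt q x y <= q (y + t *: x) - t * q x.
Proof. by move=> qs t0; apply: ge_inf; [exact: (tilt_has_inf _ _ _ qs).2|exists t]. Qed.

Lemma sublinear_tilt q x : sublinear q -> sublinear (tilt q x).
Proof.
move=> qs; have [qD qZ] := qs.
have hi y := tilt_has_inf q x y qs.
split => [y z|t y t0].
  apply/ler_addgt0Pr => e e0.
  have [_ [a /= a0 <-] qa] := inf_adherent (divr_gt0 e0 (ltr0n R 2)) (hi y).
  have [_ [b /= b0 <-] qb] := inf_adherent (divr_gt0 e0 (ltr0n R 2)) (hi z).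
  have := tilt_le q x (y + z) (a + b) qs (addr_ge0 a0 b0).
  have := qD (y + a *: x) (z + b *: x).
  rewrite addrACA -scalerDl -!/(tilt q x _) in qa qb *.
  by lra.
apply/eqP; rewrite eq_le; apply/andP; split; last first.
  apply: lb_le_inf; first by have [] := hi (t *: y).
  move=> _ [s /= s0 <-].
  move: t0; rewrite [0 <= t]le_eqVlt => /predU1P[<-|t0].
    by rewrite mul0r scale0r add0r qZ// subrr.
  rewrite -ler_pdivlMl//; apply: le_trans (tilt_le q x y (t^-1 * s) qs _) _.
    by rewrite mulr_ge0// invr_ge0 ltW.
  rewrite ler_pdivlMl// mulrBr mulrA mulVKf ?gt_eqF//.
  by rewrite -(qZ _ _ (ltW t0)) scalerDr scalerA mulVKf ?gt_eqF.
move: t0; rewrite [0 <= t]le_eqVlt => /predU1P[<-|t0].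
  apply: le_trans (tilt_le q x _ 0 qs (lexx _)) _.
  by rewrite !scale0r addr0 !mul0r subr0 sublinear0.
rewrite -ler_pdivrMl//; apply: lb_le_inf; first by have [] := hi y.
move=> _ [s /= s0 <-]; rewrite ler_pdivrMl//.
apply: le_trans (tilt_le q x _ (t * s) qs _) _; first by rewrite mulr_ge0 ?(ltW t0).
by rewrite -scalerA -scalerDr qZ ?(ltW t0)// mulrBr mulrA.
Qed.

Lemma tilt_le_id q x y : sublinear q -> tilt q x y <= q y.
Proof.
by move=> /(tilt_le q x y 0)/(_ (lexx _)); rewrite scale0r mul0r addr0 subr0.
Qed.

(** Minimality gives [tilt q x = q]; taking [t = 1] in the infimum that
    defines [tilt q x] then yields [q x + q y <= q (x + y)]. *)
Lemma minimal_sublinear_linear q : sublinear q ->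
  (forall r, sublinear r -> (forall x, r x <= q x) -> forall x, q x <= r x) ->
  linear q.
Proof.
move=> qs qmin; have [qD qZ] := qs.
have qDE x y : q (x + y) = q x + q y.
  apply/eqP; rewrite eq_le qD/=.
  have := qmin _ (sublinear_tilt q x qs) (fun y => tilt_le_id q x y qs) y.
  have := tilt_le q x y 1 qs ler01; rewrite scale1r mul1r (addrC x).
  by lra.
have qN x : q (- x) = - q x.
  by have := qDE x (- x); rewrite subrr sublinear0//; lra.
move=> a x y; rewrite qDE; congr (_ + _).
have [a0|a0] := leP 0 a; first by rewrite qZ.
have := qZ (- a) x; rewrite scaleNr qN mulNr => /(_ _)/oppr_inj; apply.
by rewrite oppr_ge0 ltW.
Qed.

(** Zorn's lemma applies to the sublinear functionals below [p] because each of
    them is at least [- p (- x)] at [x], so that chains have a pointwise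
    infimum. *)
Lemma exists_minimal_sublinear p : sublinear p ->
  exists q, [/\ sublinear q, forall x, q x <= p x &
    forall r, sublinear r -> (forall x, r x <= q x) -> forall x, q x <= r x].
Proof.
move=> ps.
pose T := {q : V -> R | sublinear q /\ forall x, q x <= p x}.
pose below (q r : T) := `[< forall x, sval r x <= sval q x >].
have p_in : sublinear p /\ forall x, p x <= p x by split.
have [||A totA|[q [qs qp]] qmax] := @ZL_preorder T (exist _ p p_in) below.
- by move=> q; apply/asboolP.
- move=> r q s /asboolP qr /asboolP rs; apply/asboolP => x.
  exact: le_trans (rs x) (qr x).
- have [A0|/set0P[q0 Aq0]] := eqVneq A set0.
    by exists (exist _ p p_in) => s; rewrite A0.
  pose B := [set sval q | q in A].
  have lbB x : has_lbound [set q x | q in B].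
    exists (- p (- x)) => _ [_ [[q [qs qp]] Aq <-] <-] /=.
    by apply: le_trans (sublinear_ge q x qs); rewrite lerN2.
  have infle (q : T) x : A q -> inf [set r x | r in B] <= sval q x.
    by move=> Aq; apply: ge_inf => //; exists (sval q) => //; exists q.
  have infB : sublinear (fun x => inf [set q x | q in B]) /\
      forall x, inf [set q x | q in B] <= p x.
    split; last first.
      by move=> x; apply: le_trans (infle q0 x Aq0) ((svalP q0).2 x).
    apply: sublinear_inf => //.
    + by exists (sval q0), q0.
    + by move=> _ [q Aq <-]; exact: (svalP q).1.
    + move=> _ _ [q Aq <-] [r Ar <-].
      have [/asboolP qr|/asboolP rq] := totA q r Aq Ar.
        by exists (sval r); [exists r|move=> x; split].
      by exists (sval q); [exists q|move=> x; split].
  by exists (exist _ (fun x => inf [set q x | q in B]) infB) => s As;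
    apply/asboolP => x; exact: infle.
- exists q; split => // r rs rq x.
  have rp : sublinear r /\ forall x, r x <= p x.
    by split => // z; exact: le_trans (rq z) (qp z).
  have /asboolP := qmax (exist _ r rp) (asboolT rq).
  exact.
Qed.

(** Any functional below [tilt p x0] is at most [- p x0] at [- x0], hence, if it
    is linear, at least [p x0] at [x0]. *)
Theorem hahn_banach_point p x0 : sublinear p ->
  exists f : V -> R, [/\ linear f, forall x, f x <= p x & f x0 = p x0].
Proof.
move=> ps.
have [f [fs fp fmin]] := exists_minimal_sublinear _ (sublinear_tilt p x0 ps).
have flin := minimal_sublinear_linear f fs fmin.
have lefp x : f x <= p x by apply: le_trans (fp x) (tilt_le_id p x0 x ps).
exists f; split => //; apply/eqP; rewrite eq_le lefp/=.
have := fp (- x0); have := tilt_le p x0 (- x0) 1 ps ler01.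
rewrite scale1r mul1r addNr sublinear0// sub0r.
have := sublinear_ge f x0 fs.
by lra.
Qed.

End hahn_banach.

(** * Completeness of the dual and boundedness of weakly convergent sequences *)

Section dual_space.
Context {R : realType} {X : normedModType R}.
Implicit Types (f g : dual X) (x : X).

Lemma dual_norm_app f x : `|f x| <= `|f| * `|x|.
Proof.
have [->|x0] := eqVneq x 0; first by rewrite linear0 !normr0 mulr0.
have nx0 : 0 < `|x| by rewrite normr_gt0.
have := dual_norm_ub f (x := `|x|^-1 *: x).
rewrite normrZ normfV normr_id mulVf ?gt_eqF// => /(_ (lexx _)).
by rewrite linearZ /= normrM normfV normr_id mulrC ler_pdivrMr.
Qed.

Lemma bounded_linear_dual (h : X -> R) (M : R) : linear h ->
  (forall x, `|h x| <= M * `|x|) -> exists f, forall x, f x = h x.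
Proof.
move=> hlin hM.
pose hL : {linear X -> R} := HB.pack h (GRing.isLinear.Build _ _ _ _ h hlin).
suff hc : h \in @cont_linear R X by exists (Dual hc).
rewrite inE; split => //.
apply: (@bounded_linear_continuous _ _ _ hL).
apply/(linear_boundedP hL); exists M; split => [|r /ltW Mr x].
  exact: num_real.
by apply: le_trans (hM x) _; rewrite ler_wpM2r.
Qed.

(** The norm is sublinear, and a linear functional below it is bounded by it in
    absolute value. *)
Lemma norming_functional x : exists2 f : dual X, `|f| <= 1 & f x = `|x|.
Proof.
have nsub : sublinear (fun x : X => `|x|).
  split => [y z|t y t0]; first exact: ler_normD.
  by rewrite normrZ ger0_norm.
have [h [hlin hle hx]] := hahn_banach_point (fun x : X => `|x|) x nsub.
have hb y : `|h y| <= `|y|.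
  rewrite ler_norml hle andbT.
  have := hle (- y); rewrite normrN -scaleN1r.
  have := hlin (-1) y 0.
  have := hlin 1 0 0; rewrite scaler0 !addr0 scale1r.
  by rewrite /GRing.scale/=; lra.
have [|f fh] := bounded_linear_dual h 1 hlin.
  by move=> y; rewrite mul1r.
exists f; last by rewrite fh.
apply: dual_norm_le => y y1; rewrite fh; exact: le_trans (hb y) y1.
Qed.

Lemma dual_ball_app g0 g (e : R) x : ball g0 e g -> `|g x - g0 x| <= e * `|x|.
Proof.
rewrite -ball_normE/= => /ltW ge.
have := dual_norm_app (g0 - g) x; rewrite distrC => /le_trans; apply.
by rewrite ler_wpM2r.
Qed.

(** The pointwise limit [h] of a Cauchy filter is linear, and the Cauchy
    estimates pass to the limit uniformly on the unit ball: this shows both that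
    [h] is bounded and that the filter converges to it in norm. *)
Lemma dual_complete (F : set_system (dual X)) :
  ProperFilter F -> cauchy F -> cvg F.
Proof.
move=> FF /cauchyP Fc.
have pt_cvg x : cvg ((fun g : dual X => g x) @ F).
  apply/cauchy_cvgP/cauchyP => e e0.
  have d0 : 0 < e / (`|x| + 1) by rewrite divr_gt0// ltr_wpDl.
  have [g0 Fg0] := Fc _ d0; exists (g0 x).
  change (\forall g \near F, ball (g0 x) e ((g : dual X) x)).
  near=> g; rewrite -ball_normE/= distrC.
  have /le_lt_trans -> // : `|g x - g0 x| <= e / (`|x| + 1) * `|x|.
    by apply: dual_ball_app; near: g; exact: Fg0.
  by rewrite mulrAC ltr_pdivrMr ?ltr_wpDl// ltr_pM2l// ltrDl.
pose h x : R := lim ((fun g : dual X => g x) @ F).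
have hlin : linear h.
  move=> a x y; apply: (cvg_lim (@Rhausdorff R)).
  under eq_fun do rewrite linearP.
  by apply: cvgD; [apply: cvgZr; exact: pt_cvg|exact: pt_cvg].
have happrox (e : R) : 0 < e ->
    exists2 g0, F (ball g0 e) & forall x, `|h x - g0 x| <= e * `|x|.
  move=> e0; have [g0 Fg0] := Fc e e0; exists g0 => // x.
  have hc : `|(g : dual X) x - g0 x| @[g --> F] --> `|h x - g0 x|.
    apply: cvg_norm; apply: cvgB; [exact: pt_cvg|exact: cvg_cst].
  apply: (closed_cvg (fun y : R => y <= e * `|x|)) hc; first exact: closed_le.
  by near=> g; apply: dual_ball_app; near: g; exact: Fg0.
have [f fh] : exists f, forall x, f x = h x.
  have [g0 _ g0h] := happrox 1 ltr01.
  apply: (bounded_linear_dual h (1 + `|g0|) hlin) => x.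
  rewrite mulrDl -(subrK (g0 x) (h x)).
  by rewrite (le_trans (ler_normD _ _))// lerD// dual_norm_app.
apply/cvg_ex; exists f; apply/cvgrPdist_lt => e e0.
have e2 : 0 < e / 2 / 2 by rewrite !divr_gt0.
have [g0 Fg0 g0h] := happrox _ e2.
have fg0 : `|f - g0| <= e / 2 / 2.
  apply: dual_norm_le => x x1.
  change (`|f x - g0 x| <= e / 2 / 2).
  by rewrite fh (le_trans (g0h x))// ler_piMr// ltW.
near=> g.
have : ball g0 (e / 2 / 2) g by near: g; exact: Fg0.
rewrite -ball_normE/= => g0g.
have := ler_distD g0 f g; lra.
Unshelve. all: by end_near. Qed.

HB.instance Definition _ := Uniform_isComplete.Build (dual X) dual_complete.

(** The evaluations at [u n] are pointwise bounded on the dual because a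
    convergent real sequence is bounded; a norming functional for [u n] turns
    their uniform bound on the unit ball into one for [`|u n|]. *)
Lemma weakly_cvg_bounded (u : nat -> X) l : weakly_cvg_to u l ->
  exists M : R, forall n, `|u n| <= M.
Proof.
move=> ul.
pose ev n (f : dual X) : R := f (u n).
have [||M HM] := @Banach_Steinhauss R (dual X) R [set ev n | n in setT] _ _ 1.
- move=> _ [n _ <-]; split; last by [].
  move=> r; exists (r * `|u n|) => f fr.
  by apply: le_trans (dual_norm_app f (u n)) _; rewrite ler_wpM2r.
- move=> f; have /cvg_seq_bounded[M [_ HM]] : cvgn (fun n => f (u n)).
    by apply/cvg_ex; exists (f l); exact: ul.
  exists (M + 1) => _ [n _ <-]; apply: (HM (M + 1)) => //; first by rewrite ltrDl.
exists M => n; have [f f1 fu] := norming_functional (u n).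
have := HM (ev n) _ f f1; rewrite /ev fu normr_id; apply.
by exists n.
Qed.

End dual_space.

(** * The weighted norm along weakly convergent sequences *)

(** The remainder is dominated by a geometric series. *)
Lemma Phi_norm_le (R : realType) (X : normedModType R) (phi : nat -> dual X)
    (x : X) (N : nat) :
  (forall k, (1 <= k)%N -> `|phi k| <= 1) ->
  Phi_norm phi x <=
    \sum_(1 <= k < N.+1) 2 ^- k * `|phi k x| + 2 ^- N * `|x|.
Proof.
move=> phi1.
pose a k : R := 2 ^- k * `|phi k x|.
have a0 k : 0 <= a k by rewrite mulr_ge0// invr_ge0 exprn_ge0.
(* the geometric sum from N+1 to N+m telescopes to 2^-N - 2^-(N+m) *)
have tail m : \sum_(N.+1 <= k < N.+1 + m) a k <= (2 ^- N - 2 ^- (N + m)) * `|x|.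
  elim: m => [|m IH]; first by rewrite addn0 big_geq// addn0 subrr mul0r.
  rewrite addnS big_nat_recr ?leq_addr//=.
  have am : a (N.+1 + m)%N <= 2 ^- (N.+1 + m) * `|x|.
    rewrite ler_wpM2l ?invr_ge0 ?exprn_ge0//.
    by rewrite (le_trans (dual_norm_app _ _))// ler_piMl// phi1.
  have E : 2 ^- (N + m) = 2 * 2 ^- (N + m).+1 :> R.
    by rewrite exprS invfM mulVKf ?pnatr_eq0.
  rewrite E in IH; rewrite addSn in am; rewrite addnS addSn.
  by lra.
have part m : \sum_(1 <= k < m) a k <=
    \sum_(1 <= k < N.+1) a k + 2 ^- N * `|x|.
  have [mN|Nm] := leqP m N.+1.
    apply: le_trans (_ : \sum_(1 <= k < N.+1) a k <= _); last first.
      by rewrite lerDl mulr_ge0// invr_ge0 exprn_ge0.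
    case: m mN => [|m] mN; first by rewrite big_geq// sumr_ge0.
    by rewrite [leRHS](@big_cat_nat _ _ _ m.+1)//= lerDl sumr_ge0.
  rewrite (@big_cat_nat _ _ _ N.+1)//= ?(ltnW Nm)// lerD2l.
  rewrite -{1}(subnKC (ltnW Nm)); apply: le_trans (tail _) _.
  by rewrite ler_wpM2r// gerBl invr_ge0 exprn_ge0.
(* the limit defining the series exists, as its partial sums are monotone *)
apply: limr_le; last by apply: nearW => m; exact: part.
apply: nondecreasing_is_cvgn.
  apply/nondecreasing_seqP => m; case: m => [|m]; first by rewrite !big_geq.
  by rewrite [leRHS]big_nat_recr//= lerDl.
by exists (\sum_(1 <= k < N.+1) a k + 2 ^- N * `|x|) => _ [m _ <-].
Qed.

Lemma Phi_norm_weakly_small (R : realType) (X : normedModType R) (phi : nat -> dual X)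
    (v : nat -> X) :
  (forall k, (1 <= k)%N -> `|phi k| <= 1) ->
  weakly_cvg_to v 0 -> forall e : R, 0 < e ->
    \forall n \near \oo, Phi_norm phi (v n) < e.
Proof.
move=> phi1 v0 e e0; have [M vM] := weakly_cvg_bounded v 0 v0.
have M0 : 0 <= M by exact: le_trans (vM 0%N).
have d0 : 0 < e / 2 / (M + 1) by rewrite !divr_gt0// ltr_wpDl.
have [N N2] : exists N, 2 ^- N < e / 2 / (M + 1).
  have /cvgr_lt/(_ _ d0) : (2^-1 ^+ n : R) @[n --> \oo] --> 0.
    by apply: cvg_expr; rewrite ger0_norm ?invr_ge0// invf_lt1// ltr1n.
  by case=> N _ /(_ N (leqnn N)); rewrite /= exprVn => ?; exists N.
have head : \sum_(1 <= k < N.+1) 2 ^- k * `|phi k (v n)| @[n --> \oo] --> (0 : R).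
  rewrite [X in _ --> X](_ : _ = \sum_(1 <= k < N.+1) 0); last by rewrite big1.
  apply: cvg_big => [|k _]; first exact: add_continuous.
  rewrite -(mulr0 (2 ^- k)); apply: cvgM; first exact: cvg_cst.
  rewrite -(@normr0 _ R); apply: cvg_norm.
  by rewrite -(linear0 (phi k)); exact: v0.
near=> n; apply: le_lt_trans (Phi_norm_le _ _ phi (v n) N phi1) _.
rewrite [e]splitr; apply: ltr_leD.
  by near: n; apply: cvgr_lt head _ _; rewrite divr_gt0.
rewrite (@le_trans _ _ (e / 2 / (M + 1) * (M + 1)))//; last first.
  by rewrite divfK// gt_eqF// ltr_wpDl.
rewrite ler_pM ?invr_ge0 ?exprn_ge0//; first exact: ltW.
by rewrite (le_trans (vM n))// lerDl.
Unshelve. all: by end_near. Qed.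

(** * Complete continuity *)

Theorem mainTheorem3 (R : realType) (X Y : normedModType R)
  (sepX : separable (dual X))
  (phi : nat -> dual X)
  (Phi_dense : dense_subset [set f : dual X | `|f| <= 1]
                 [set phi k | k in [set k | (1 <= k)%N]])
  (T : {linear X -> Y})
  (T_bound : forall eps : R, 0 < eps ->
     exists2 C : R, 0 < C &
       forall u : X, `|T u| <= eps * `|u| + C * Phi_norm phi u) :
  completely_continuous T.
Proof.
move=> u [l ul]; apply/cvg_ex; exists (T l).
pose v n := u n - l.
have v0 : weakly_cvg_to v 0.
  move=> f; rewrite linear0 -(subrr (f l)) /v.
  under eq_fun do rewrite linearB.
  by apply: cvgB; [exact: ul|exact: cvg_cst].
have phi1 k : (1 <= k)%N -> `|phi k| <= 1.
  by move=> k1; apply: Phi_dense.1; exists k.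
have [M vM] := weakly_cvg_bounded v 0 v0.
apply/cvgrPdist_lt => e e0.
have M0 : 0 <= M by exact: le_trans (vM 0%N).
have d0 : 0 < e / 2 / (M + 1) by rewrite !divr_gt0// ltr_wpDl.
(* eps is chosen so that eps * |v n| <= e / 2 for all n, as |v n| <= M *)
have [C C0 TC] := T_bound _ d0.
near=> n.
rewrite distrC -linearB -/(v n); apply: le_lt_trans (TC (v n)) _.
rewrite [ltRHS]splitr; apply: ler_ltD.
  rewrite (@le_trans _ _ (e / 2 / (M + 1) * (M + 1)))//; last first.
    by rewrite divfK// gt_eqF// ltr_wpDl.
  by rewrite ler_pM2l// (le_trans (vM n))// lerDl.
rewrite -ltr_pdivlMl// mulrC.
near: n; apply: (Phi_norm_weakly_small _ _ _ _ phi1 v0).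
by rewrite !divr_gt0.
Unshelve. all: by end_near. Qed.
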